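(* Let $G$ be a graph with $n$ vertices and assume $\mathrm{Pin}(G,k) \ne \emptyset$. If the poset $\mathcal{P}(G,k)$ has a minimum element, then $\mathcal{P}(G,k)$ is a distributive lattice. In this case, for any two pinnacle sets $P, Q \in \mathrm{Pin}(G,k)$ with $P = \{p_1, p_2, \ldots, p_k\}$ and $Q = \{q_1, q_2, \ldots, q_k\}$ (elements listed in increasing order), their meet is $P \land Q = \{\min\{p_i, q_i\} : i = 1, 2, \ldots, k\}$.
   Context: Graphs are finite and simple, and $[n] = \{1,2,\ldots,n\}$. A labeling of a graph $G$ with $n$ vertices is a bijection $\lambda : V(G) \to [n]$. The label $\lambda(u)$ of a vertex $u$ is a pinnacle of $(G,\lambda)$ if $\lambda(u) > \lambda(v)$ for every neighbor $v$ of $u$ (so the label of an isolated vertex is vacuously a pinnacle). The pinnacle set of $(G,\lambda)$ is the set of all pinnacles of $(G,\lambda)$. A subset $S \subseteq [n]$ is a pinnacle set of $G$ if there is a labeling $\lambda$ of $G$ such that $S$ is the pinnacle set of $(G,\lambda)$. $\mathrm{Pin}(G,k)$ denotes the collection of all size-$k$ pinnacle sets of $G$. For $P = \{p_1 < p_2 < \cdots < p_k\}$ and $Q = \{q_1 < q_2 < \cdots < q_k\}$ in $\mathrm{Pin}(G,k)$, define $P \preceq Q$ if and only if $p_i \le q_i$ for $i = 1, \ldots, k$. Then $\mathcal{P}(G,k) = (\mathrm{Pin}(G,k), \preceq)$ is a partial order. A minimum element is one that is $\preceq$ every element of the poset. The meet of two elements is their greatest lower bound. *)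

(* Defs.v *)
From HB Require Import structures.
From mathcomp Require Import all_boot all_order.

Set Implicit Arguments.
Unset Strict Implicit.
Unset Printing Implicit Defensive.

Import Order.TTheory.

Section Pinnacles.

Variables (T : finType) (e : rel T) (n : nat).

(* The label set {1, ..., n} is encoded as 'I_n: the ordinal i stands for the
   label i + 1. Only comparisons of labels are ever used. *)
Definition labeling (lam : {ffun T -> 'I_n}) : bool :=
  injectiveb lam && [forall i, i \in codom lam].

Definition pinnacle_at (lam : {ffun T -> 'I_n}) (u : T) : bool :=
  [forall v, e u v ==> (lam v < lam u)%N].

Definition pinnacle_set_of (lam : {ffun T -> 'I_n}) : {set 'I_n} :=
  [set lam u | u in T & pinnacle_at lam u].

Definition pinnacle_set (S : {set 'I_n}) : bool :=
  [exists lam : {ffun T -> 'I_n}, labeling lam && (pinnacle_set_of lam == S)].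

Definition Pin (k : nat) : {set {set 'I_n}} :=
  [set S | pinnacle_set S & #|S| == k].

Lemma labelingP (lam : {ffun T -> 'I_n}) : reflect (bijective lam) (labeling lam).
Proof.
apply: (iffP andP) => [[/injectiveP inj_lam /forallP sur_lam]|bij_lam].
  exists (fun i => iinv (sur_lam i)) => [x|i]; last exact: f_iinv.
  by apply: inj_lam; rewrite f_iinv.
split; first exact/injectiveP/bij_inj.
by apply/forallP => i; have [g _ gK] := bij_lam; rewrite -(gK i) codom_f.
Qed.

End Pinnacles.

Record pin_poset (T : finType) (e : rel T) (n k : nat) := PinPoset {
  pin_set :> {set 'I_n};
  _ : pin_set \in Pin e n k
}.

Fact pin_display : Order.disp_t. Proof. exact: Order.Disp tt tt. Qed.

Section PinPoset.

Variables (T : finType) (e : rel T) (n k : nat).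
Local Notation pin := (pin_poset e n k).

HB.instance Definition _ := [isSub for @pin_set T e n k].
HB.instance Definition _ := [Finite of pin by <:].

Lemma card_pin (P : pin) : #|pin_set P| = k.
Proof. by have := valP P; rewrite inE => /andP[_ /eqP]. Qed.

(* The element of rank i of P in increasing order, counting from 0; the
   enumeration of a set of ordinals is increasing (see pin_nth_lt). *)
Definition pin_nth (P : pin) (i : 'I_k) : 'I_n :=
  enum_val (cast_ord (esym (card_pin P)) i).

Lemma pin_nth_lt (P : pin) (i j : 'I_k) :
  (i < j)%N -> (pin_nth P i < pin_nth P j)%N.
Proof.
move=> ltij; have x0 := pin_nth P i.
have srt : sorted ltn (map val (enum (pin_set P))).
  apply: (subseq_sorted ltn_trans _ (iota_ltn_sorted 0 n)).
  rewrite -val_enum_ord; apply: map_subseq.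
  by rewrite {1}/enum_mem -enumT; apply: filter_subseq.
have szP : size (enum (pin_set P)) = k by rewrite -cardE card_pin.
rewrite /pin_nth !(enum_val_nth x0) /=.
have nthE (l : 'I_k) :
    nth x0 (enum (pin_set P)) l = nth 0 (map val (enum (pin_set P))) l :> nat.
  by rewrite (nth_map x0) // szP.
rewrite !nthE; apply: (sorted_ltn_nth ltn_trans) => //;
  by rewrite inE size_map szP.
Qed.

Lemma pin_nth_image (P : pin) : [set pin_nth P i | i : 'I_k] = pin_set P.
Proof.
apply/setP => x; apply/imsetP/idP => [[i _ ->]|xP]; first exact: enum_valP.
exists (cast_ord (card_pin P) (enum_rank_in xP x)) => //.
by rewrite /pin_nth cast_ordK enum_rankK_in.
Qed.

Definition pin_le (P Q : pin) : bool :=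
  [forall i : 'I_k, (pin_nth P i <= pin_nth Q i)%N].

Fact pin_le_refl : reflexive pin_le.
Proof. by move=> P; apply/forallP. Qed.

Fact pin_le_anti : antisymmetric pin_le.
Proof.
move=> P Q /andP[/forallP lePQ /forallP leQP]; apply: val_inj => /=.
rewrite -(pin_nth_image P) -(pin_nth_image Q); apply: eq_imset => i.
by apply/val_inj/eqP; rewrite eqn_leq lePQ leQP.
Qed.

Fact pin_le_trans : transitive pin_le.
Proof.
move=> Q P R /forallP lePQ /forallP leQR; apply/forallP => i.
exact: leq_trans (lePQ i) (leQR i).
Qed.

HB.instance Definition _ :=
  Order.Le_isPOrder.Build pin_display pin pin_le_refl pin_le_anti pin_le_trans.

Lemma pin_leE (P Q : pin) : (P <= Q)%O = pin_le P Q.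
Proof. by []. Qed.

End PinPoset.

(* Main.v *)
Require Import Defs.
From HB Require Import structures.
From mathcomp Require Import all_boot all_order.

(** The heart of the matter is that, among the k-subsets of the label set, the
    pinnacle sets of a graph form an up-set for the componentwise order
    ([pinnacle_set_upward]). A labeling can be read as placing the vertices one
    at a time by decreasing label; a vertex carries a pinnacle exactly when it
    is adjacent to no vertex placed before it. If Q dominates P, reshuffle the
    placement for P so that the pinnacle vertices receive the labels in Q and
    the other vertices the remaining labels, keeping the order within each of
    the two families ([reshuffling]). Every pinnacle vertex then comes at least
    as early as before and every other vertex at least as late, which preserves
    both defining conditions: a pinnacle vertex is adjacent only to
    non-pinnacle vertices, and those still come later, while a non-pinnacle
    vertex keeps the earlier neighbor it had.

    Componentwise maxima of pinnacle sets are therefore pinnacle sets. If there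
    is a minimum M, the pinnacle sets of size k are exactly the k-subsets above
    M, so componentwise minima are pinnacle sets as well. The poset then embeds
    in a power of a chain as a set of points closed under componentwise minimum
    and maximum, which makes it a distributive lattice with these operations as
    meet and join. *)

Set Implicit Arguments.
Unset Strict Implicit.
Unset Printing Implicit Defensive.

Import Order.TTheory.

(** * Ranks in sets of labels *)

Definition rank n (A : {set 'I_n}) (t : nat) := #|[set y in A | (y < t)%N]|.

Section Rank.

Variable n : nat.
Implicit Types (A B : {set 'I_n}) (x y : 'I_n).

Lemma rank_leq A s t : (s <= t)%N -> (rank A s <= rank A t)%N.
Proof.
move=> le_st; apply/subset_leq_card/subsetP => y; rewrite !inE => /andP[-> /=].
by move/leq_trans; apply.
Qed.

Lemma rank_ltn A x t : x \in A -> (x < t)%N -> (rank A x < rank A t)%N.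
Proof.
move=> xA ltxt; apply/proper_card/properP; split.
  apply/subsetP => y; rewrite !inE => /andP[-> /=] /ltn_trans; exact.
by exists x; rewrite !inE xA ?ltnn.
Qed.

Lemma rank_inj A : {in A &, injective (fun x => rank A x)}.
Proof.
move=> x y xA yA /= eq_r; apply/val_inj.
by case: (ltngtP x y) => // [/(rank_ltn xA)|/(rank_ltn yA)]; rewrite eq_r ltnn.
Qed.

(** Ranks in A are distinct and smaller than the cardinal of A, so they fill
    the whole interval. *)
Lemma rank_surj A r : (r < #|A|)%N -> exists2 x, x \in A & rank A x = r.
Proof.
move=> ltrA; pose s := [seq rank A x | x : 'I_n in A].
have us : uniq s.
  by apply/dinjectiveP; exact: rank_inj.
have sub_s : {subset s <= iota 0 #|A|}.
  move=> _ /imageP[x xA ->]; rewrite mem_iota /=.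
  apply: (leq_trans (rank_ltn xA (ltn_ord x))).
  by apply/subset_leq_card/subsetP => y; rewrite inE => /andP[].
have [//|_ /(_ r)] := uniq_min_size us sub_s.
  by rewrite size_iota size_image.
by rewrite mem_iota /= add0n ltrA => /imageP[x xA ->]; exists x.
Qed.

Lemma rankC A t : (rank A t + rank (~: A) t = rank [set: 'I_n] t)%N.
Proof.
rewrite /rank -[RHS](cardsID A); congr (_ + _)%N;
  by apply: eq_card => y; rewrite !inE andbC.
Qed.

(** If y were smaller than x, then B would count more elements than A up to
    and including y. *)
Lemma rank_dominated A B x y :
    (forall t, rank B t <= rank A t)%N ->
  y \in B -> rank A x = rank B y -> (x <= y)%N.
Proof.
move=> domAB yB eq_r; rewrite leqNgt; apply/negP => ltyx.
have := leq_trans (rank_ltn yB (ltnSn y)) (leq_trans (domAB _) (rank_leq A ltyx)).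
by rewrite eq_r ltnn.
Qed.

Lemma rank_imset k (f : 'I_k -> 'I_n) t :
  injective f -> rank [set f i | i : 'I_k] t = #|[set i | (f i < t)%N]|.
Proof.
move=> f_inj; rewrite /rank -(card_imset _ f_inj); apply: eq_card => y.
rewrite !inE; apply/andP/imsetP => [[/imsetP[i _ ->] lti]|[i]].
  by exists i; rewrite ?inE.
by rewrite inE => lti ->; rewrite imset_f.
Qed.

Lemma rank_imset_leq k (f g : 'I_k -> 'I_n) t :
    injective f -> injective g -> (forall i, f i <= g i)%N ->
  (rank [set g i | i : 'I_k] t <= rank [set f i | i : 'I_k] t)%N.
Proof.
move=> f_inj g_inj lefg; rewrite !rank_imset //.
apply/subset_leq_card/subsetP => i; rewrite !inE; exact: leq_ltn_trans.
Qed.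

Lemma ltn_homo_inj k (f : 'I_k -> 'I_n) :
  {homo f : i j / (i < j)%N} -> injective f.
Proof.
move=> f_lt i j eqf; apply/val_inj.
by case: (ltngtP i j) => // /f_lt; rewrite eqf ltnn.
Qed.

Lemma rank_ltn_homo k (f : 'I_k -> 'I_n) (i : 'I_k) :
  {homo f : i j / (i < j)%N} -> rank [set f j | j : 'I_k] (f i) = i.
Proof.
move=> f_lt; rewrite rank_imset; last exact: ltn_homo_inj.
transitivity #|[set j : 'I_k | (j < i)%N]|.
  apply: eq_card => j; rewrite !inE.
  case: (ltngtP j i) => [/f_lt->//|/f_lt ltf|/val_inj->]; last by rewrite ltnn.
  by apply/negbTE; rewrite -leqNgt ltnW.
rewrite -sum1dep_card (big_ord_narrow (ltnW (ltn_ord i))).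
by rewrite sum_nat_const card_ord muln1.
Qed.

(** The permutation sends each element of P (resp. of the complement of P) to
    the element of the same rank in Q (resp. in the complement of Q).
    Complementation reverses dominance, hence the opposite inequalities. *)
Lemma reshuffling (P Q : {set 'I_n}) :
    #|P| = #|Q| -> (forall t, rank Q t <= rank P t)%N ->
  exists s : 'I_n -> 'I_n,
    [/\ injective s, forall x, (s x \in Q) = (x \in P),
        {in P, forall x : 'I_n, (x <= s x)%N},
        {in ~: P, forall x : 'I_n, (s x <= x)%N}
      & {in ~: P &, {homo s : x y / (x < y)%N}}].
Proof.
move=> eq_card dom.
have domC t : (rank (~: P) t <= rank (~: Q) t)%N.
  by rewrite -(leq_add2l (rank P t)) rankC -(rankC Q) leq_add2r dom.
pose side (A : {set 'I_n}) (b : bool) := if b then A else ~: A.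
have mem_side A x b : (x \in side A b) = ((x \in A) == b).
  by case: b; rewrite ?inE; case: (x \in A).
have card_side b : #|side P b| = #|side Q b|.
  by case: b => //=; rewrite [LHS]cardsCs [RHS]cardsCs !setCK eq_card.
have ex_s x : exists y, (y \in side Q (x \in P)) &&
    (rank (side Q (x \in P)) y == rank (side P (x \in P)) x).
  have ltr : (rank (side P (x \in P)) x < #|side Q (x \in P)|)%N.
    rewrite -card_side; apply/proper_card/properP; split.
      by apply/subsetP => y; rewrite inE => /andP[].
    by exists x; rewrite ?inE ?ltnn ?andbF // mem_side.
  by have [y yQ eq_r] := rank_surj ltr; exists y; rewrite yQ eq_r /=.
have [s sP] := fin_all_exists ex_s.
have sQ x : (s x \in Q) = (x \in P).
  by have /andP[] := sP x; rewrite mem_side => /eqP.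
have sr b x : (x \in P) = b -> rank (side Q b) (s x) = rank (side P b) x.
  by move=> <-; have /andP[_ /eqP] := sP x.
exists s; split=> //.
- move=> x y eq_s; have eq_in : (x \in P) = (y \in P) by rewrite -!sQ eq_s.
  apply: (rank_inj (A := side P (y \in P))); rewrite ?mem_side ?eq_in ?eqxx //=.
  by rewrite -!sr // eq_s.
- move=> x xP; apply: (rank_dominated dom); first by rewrite sQ.
  by have := sr true x xP.
- move=> x; rewrite inE => xNP; apply: (rank_dominated domC).
    by rewrite inE.
  by have := sr false x (negbTE xNP).
- move=> x y xNP; rewrite inE => yNP ltxy; rewrite ltnNge; apply/negP => les.
  have := rank_leq (~: Q) les; have ltr := rank_ltn xNP ltxy.
  rewrite inE in xNP.
  have /= -> := sr false x (negbTE xNP); have /= -> := sr false y (negbTE yNP).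
  by rewrite leqNgt ltr.
Qed.

End Rank.

(** * Pinnacle sets form an up-set *)

Section Upward.

Variables (T : finType) (e : rel T) (n : nat).
Hypotheses (e_sym : symmetric e) (e_irr : irreflexive e) (cardT : #|T| = n).

Lemma mem_pinnacle_set_of (lam : {ffun T -> 'I_n}) u :
  injective lam -> (lam u \in pinnacle_set_of e lam) = pinnacle_at e lam u.
Proof. by move=> lam_inj; rewrite mem_imset // inE. Qed.

Lemma pinnacle_set_upward (P Q : {set 'I_n}) :
    pinnacle_set e P -> #|P| = #|Q| -> (forall t, rank Q t <= rank P t)%N ->
  pinnacle_set e Q.
Proof.
case/existsP => lam /andP[/labelingP lam_bij /eqP defP] eq_card dom.
have [s [s_inj sQ s_up s_down s_homo]] := reshuffling eq_card dom.
have lam_inj := bij_inj lam_bij.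
have PE u : (lam u \in P) = pinnacle_at e lam u.
  by rewrite -defP mem_pinnacle_set_of.
pose mu : {ffun T -> 'I_n} := [ffun u => s (lam u)].
have muE u : mu u = s (lam u) by rewrite ffunE.
have mu_inj : injective mu.
  by move=> u v; rewrite !muE => /s_inj/lam_inj.
have mu_bij : bijective mu by apply: inj_card_bij; rewrite // card_ord cardT.
apply/existsP; exists mu; apply/andP; split; first exact/labelingP.
apply/eqP/setP => x; have [g _ gK] := mu_bij; rewrite -(gK x).
move: (g x) => u {gK x}.
rewrite mem_pinnacle_set_of // muE sQ PE.
apply/idP/idP; last first.
  (* A neighbor of a pinnacle vertex is not a pinnacle vertex, so its label can
     only decrease while that of the pinnacle vertex can only increase. *)
  move=> pin_u; apply/forallP => v; apply/implyP => euv.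
  have ltvu : (lam v < lam u)%N by have /forallP/(_ v) := pin_u; rewrite euv.
  have vNP : lam v \in ~: P.
    rewrite inE PE; apply/negP => /forallP/(_ u).
    by rewrite e_sym euv /= ltnNge ltnW.
  rewrite !muE; apply: leq_ltn_trans (s_down _ vNP) _.
  by apply: leq_trans ltvu (s_up _ _); rewrite PE.
(* Conversely, a larger neighbor of u survives: the label of u can only
   decrease, and a neighbor label either can only increase, or belongs like
   that of u to the part on which s is increasing. *)
move=> pin_u; rewrite -[_ lam u]negbK; apply/negP => not_pin.
have uNP : lam u \in ~: P by rewrite inE PE.
have [v euv ltuv] : exists2 v, e u v & (lam u < lam v)%N.
  move: not_pin; rewrite negb_forall => /existsP[v].
  rewrite negb_imply -leqNgt => /andP[euv leuv]; exists v => //.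
  rewrite ltn_neqAle leuv andbT; apply/eqP => /val_inj/lam_inj eq_uv.
  by rewrite eq_uv e_irr in euv.
have : (mu v < mu u)%N by have /forallP/(_ v) := pin_u; rewrite euv.
rewrite ltnNge !muE => /negP; apply; apply: ltnW.
have [vP|vNP] := boolP (lam v \in P); last by apply: s_homo; rewrite // inE.
exact: leq_ltn_trans (s_down _ uNP) (leq_trans ltuv (s_up _ vP)).
Qed.

Variable k : nat.
Local Notation pin := (pin_poset e n k).

Lemma pin_nth_inj (P : pin) : injective (pin_nth P).
Proof. apply: ltn_homo_inj; exact: pin_nth_lt. Qed.

Lemma pin_nth_unique (P : pin) (f : 'I_k -> 'I_n) :
    {homo f : i j / (i < j)%N} -> pin_set P = [set f i | i : 'I_k] ->
  forall i, pin_nth P i = f i.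
Proof.
move=> f_lt defP i; apply: (rank_inj (A := P)).
- exact: enum_valP.
- by rewrite defP imset_f.
- have := rank_ltn_homo i f_lt; have := rank_ltn_homo i (@pin_nth_lt _ _ _ _ P).
  by rewrite pin_nth_image -defP => -> ->.
Qed.

Lemma pin_above (P : pin) (f : 'I_k -> 'I_n) :
    (forall i j : 'I_k, (i < j)%N -> (f i < f j)%O) ->
    (forall i, pin_nth P i <= f i)%O ->
  exists R : pin, forall i, pin_nth R i = f i.
Proof.
move=> f_ltO leP; have f_lt : {homo f : i j / (i < j)%N} := f_ltO.
have f_inj := ltn_homo_inj f_lt.
suff RP : [set f i | i : 'I_k] \in Pin e n k.
  by exists (PinPoset RP); exact: pin_nth_unique.
have card_f : #|[set f i | i : 'I_k]| = k by rewrite card_imset ?card_ord.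
have pinP : pinnacle_set e (pin_set P).
  by have := valP P; rewrite inE => /andP[].
rewrite inE card_f eqxx andbT.
apply: pinnacle_set_upward pinP _ _; first by rewrite card_pin.
move=> t; rewrite -pin_nth_image; apply: rank_imset_leq => //.
exact: pin_nth_inj.
Qed.

(** * Meets and joins *)

Lemma pin_leP (P Q : pin) :
  reflect (forall i, (pin_nth P i <= pin_nth Q i)%O) (P <= Q)%O.
Proof. exact: forallP. Qed.

Lemma pin_nth_ltO (P : pin) (i j : 'I_k) :
  (i < j)%N -> (pin_nth P i < pin_nth P j)%O.
Proof. exact: pin_nth_lt. Qed.

Lemma pin_max (P Q : pin) :
  exists R : pin, forall i, pin_nth R i = Order.max (pin_nth P i) (pin_nth Q i).
Proof.
apply: (pin_above (P := P)) => [i j ltij|i]; last by rewrite le_max lexx.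
by rewrite gt_max !lt_max !pin_nth_ltO ?orbT.
Qed.

(** A lower bound M of P and Q lies below their componentwise minimum, which
    the up-set property then makes a pinnacle set. *)
Lemma pin_min (M P Q : pin) : (M <= P)%O -> (M <= Q)%O ->
  exists R : pin, forall i, pin_nth R i = Order.min (pin_nth P i) (pin_nth Q i).
Proof.
move=> /pin_leP leMP /pin_leP leMQ.
apply: (pin_above (P := M)) => [i j ltij|i]; last by rewrite le_min leMP leMQ.
by rewrite lt_min !gt_min !pin_nth_ltO ?orbT.
Qed.

Lemma pin_nth_ext (P Q : pin) : (forall i, pin_nth P i = pin_nth Q i) -> P = Q.
Proof.
move=> eqPQ; apply: val_inj; rewrite /= -!pin_nth_image; exact: eq_imset.
Qed.

End Upward.

Theorem corollary5p4p1 (T : finType) (e : rel T) (n k : nat)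
    (e_sym : symmetric e) (e_irr : irreflexive e) (cardT : #|T| = n)
    (Pin_neq0 : Pin e n k != set0) :
  (exists M : pin_poset e n k, forall P : pin_poset e n k, (M <= P)%O) ->
  exists c : Order.DistrLattice.axioms_ pin_display (pin_poset e n k),
    let L : distrLatticeType pin_display := Order.DistrLattice.Pack c in
    (forall P Q : L, (P <= Q)%O = pin_le P Q) /\
    (forall P Q : L,
       pin_set (P `&` Q)%O =
         [set Order.min (pin_nth P i) (pin_nth Q i) | i : 'I_k]).
Proof.
move=> [M minM]; set pin := pin_poset e n k.
have [join joinE] : exists join : pin * pin -> pin, forall PQ i,
    pin_nth (join PQ) i = Order.max (pin_nth PQ.1 i) (pin_nth PQ.2 i).
  exact: (fin_all_exists (fun PQ : pin * pin =>
    pin_max e_sym e_irr cardT PQ.1 PQ.2)).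
have [meet meetE] : exists meet : pin * pin -> pin, forall PQ i,
    pin_nth (meet PQ) i = Order.min (pin_nth PQ.1 i) (pin_nth PQ.2 i).
  exact: (fin_all_exists (fun PQ : pin * pin =>
    pin_min e_sym e_irr cardT (minM PQ.1) (minM PQ.2))).
have meetP (P Q R : pin) : (P <= meet (Q, R))%O = (P <= Q)%O && (P <= R)%O.
  apply/pin_leP/andP => [leP|[/pin_leP leQ /pin_leP leR] i].
    by split; apply/pin_leP => i; have := leP i; rewrite meetE le_min => /andP[].
  by rewrite meetE le_min leQ leR.
have joinP (P Q R : pin) : (join (P, Q) <= R)%O = (P <= R)%O && (Q <= R)%O.
  apply/pin_leP/andP => [leR|[/pin_leP leP /pin_leP leQ] i].
    by split; apply/pin_leP => i; have := leR i; rewrite joinE ge_max => /andP[].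
  by rewrite joinE ge_max leP leQ.
have meetUl (P Q R : pin) :
    meet (join (P, Q), R) = join (meet (P, R), meet (Q, R)).
  by apply: pin_nth_ext => i; rewrite !(meetE, joinE) /= min_maxl.
pose lat := Order.POrder_MeetJoin_isLattice.Build pin_display pin meetP joinP.
pose L0 : latticeType pin_display := HB.pack pin lat.
pose dist := Order.Lattice_Meet_isDistrLattice.Build pin_display L0 meetUl.
pose L : distrLatticeType pin_display := HB.pack pin lat dist.
exists (Order.DistrLattice.class L); split=> // P Q.
rewrite -pin_nth_image; apply: eq_imset => i; exact: (meetE (P, Q)).
Qed.
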